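(* Let $G=(V,E)$ be a uniquely $k$-colorable graph with $n$ vertices and $m$ edges, and let $A_1,\ldots,A_k$ be the color classes of its unique $k$-coloring. Let $r_o$ (respectively $r_e$) be the number of classes $A_i$ of odd (respectively even) size. Let $p_o$ (respectively $p_e$) be the number of pairs $(i,j)$ with $1\le i<j\le k$ such that both $|A_i|$ and $|A_j|$ are odd (respectively both are even) and $e(A_i,A_j)$ is odd. If $$m\le\max\Big\{(n-r_o)(k-1)+\binom{r_o}{2}-p_e,\ (n-r_e)(k-1)+\binom{r_e}{2}-p_o\Big\},$$ then $AT(G)=k$.
   Context: A graph is uniquely $k$-colorable if it has exactly one proper vertex $k$-coloring up to permutation of the color classes. $e(A_i,A_j)$ denotes the number of edges with one endpoint in $A_i$ and the other in $A_j$. For $G$ with vertex set $\{1,\ldots,n\}$, the graph polynomial is $P_G(x_1,\ldots,x_n)=\prod_{i<j,\ (i,j)\in E}(x_i-x_j)$. $G$ is Alon-Tarsi $k$-choosable if the expansion of $P_G$ contains a monomial $c\prod_i x_i^{t_i}$ with real coefficient $c\ne0$ and $t_i\le k-1$ for all $i$; the Alon-Tarsi number $AT(G)$ is the smallest $k$ for which $G$ is Alon-Tarsi $k$-choosable. *)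

(* Defs.v *)
From HB Require Import structures.
From mathcomp Require Import all_boot all_order all_algebra all_fingroup.
From mathcomp Require Import mpoly.

Set Implicit Arguments.
Unset Strict Implicit.
Unset Printing Implicit Defensive.

Import Order.TTheory GRing.Theory Num.Theory.
Local Open Scope ring_scope.

Record sgraph (n : nat) := SGraph {
  adj :> rel 'I_n;
  adj_sym : ssrbool.symmetric adj;
  adj_irr : irreflexive adj
}.

(* Each edge is represented once, by the pair (i, j) with i < j. *)
Definition edges n (G : sgraph n) : {set 'I_n * 'I_n} :=
  [set p : 'I_n * 'I_n | (p.1 < p.2)%N && G p.1 p.2].

Definition edges_between n (G : sgraph n) (A B : {set 'I_n}) : nat :=
  #|[set p in edges G | (p.1 \in A) && (p.2 \in B)
                        || (p.1 \in B) && (p.2 \in A)]|.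

Definition proper_coloring n k (G : sgraph n) (c : {ffun 'I_n -> 'I_k}) : Prop :=
  forall u v, G u v -> c u != c v.

Definition color_class n k (c : {ffun 'I_n -> 'I_k}) (i : 'I_k) : {set 'I_n} :=
  [set v | c v == i].

(* The k color classes are required to be nonempty, so that k is the chromatic
   number. This only excludes the complete graphs on fewer than k vertices,
   whose k-colorings are all equal up to a permutation of the colors. The
   competing colorings c' are arbitrary maps and may leave colors unused. *)
Definition uniquely_colorable n (G : sgraph n) (k : nat) : Prop :=
  exists c : {ffun 'I_n -> 'I_k},
    [/\ proper_coloring G c,
        forall i, color_class c i != set0
      & forall c' : {ffun 'I_n -> 'I_k}, proper_coloring G c' ->
          exists s : {perm 'I_k}, forall v, c' v = s (c v)].

(* Number of classes whose size is odd (b = true) or even (b = false). *)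
Definition nb_classes n k (A : 'I_k -> {set 'I_n}) (b : bool) : nat :=
  #|[set i | odd #|A i| == b]|.

Definition nb_odd_pairs n k (G : sgraph n) (A : 'I_k -> {set 'I_n})
    (b : bool) : nat :=
  #|[set ij : 'I_k * 'I_k | [&& (ij.1 < ij.2)%N,
       odd #|A ij.1| == b, odd #|A ij.2| == b
     & odd (edges_between G (A ij.1) (A ij.2))]]|.

Section AlonTarsi.
Variables (R : realFieldType) (n : nat) (G : sgraph n).

Definition graph_poly : {mpoly R[n]} :=
  \prod_(p in edges G) ('X_(p.1) - 'X_(p.2)).

(* [t i < k] is t_i <= k - 1, without truncated subtraction. *)
Definition AT_choosable (k : nat) : bool :=
  has (fun t : 'X_{1..n} => [forall i, t i < k]%N) (msupp graph_poly).

Lemma graph_poly_neq0 : graph_poly != 0.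
Proof.
rewrite /graph_poly prodf_seq_neq0; apply/allP => -[i j] _ /=.
apply/implyP; rewrite inE /= => /andP[lt_ij _].
rewrite subr_eq0; apply/eqP => /(congr1 (mcoeff U_(i))).
rewrite !mcoeffX eqxx; case: eqP => [/mnmP/(_ i)|_ /eqP]; last first.
  by rewrite oner_eq0.
rewrite !mnm1E eqxx; case: eqP => // eq_ji _.
by rewrite eq_ji ltnn in lt_ij.
Qed.

Lemma AT_choosable_ex : exists k, AT_choosable k.
Proof.
exists (mdeg (mlead graph_poly)).+1; apply/hasP.
exists (mlead graph_poly); first exact/mlead_supp/graph_poly_neq0.
by apply/forallP => i; rewrite ltnS mdegE (bigD1 i) //= leq_addr.
Qed.

Definition AT : nat := ex_minn AT_choosable_ex.

End AlonTarsi.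

(* Main.v *)
(* AT(G) <= k: by Lagrange interpolation, the coefficient of prod_v x_v^(k-1) in
   a polynomial f of degree at most n(k-1) is the sum over a in {0..k-1}^n of
   f(a) / prod_v phi'(a_v), where phi = prod_i (X - i).  Let S be the set of
   pairs i < j for which e(A_i, A_j) and |A_i| + |A_j| have different parities,
   and apply this to f = P_G Q, where Q = prod_{(i,j) in S} (x_{r_i} - x_{r_j})
   and r_i is a vertex of A_i.  Only the recolorings s o c of the given coloring
   c contribute, each by a constant sign times a product over i < j of even
   powers of s_i - s_j, so the coefficient is nonzero, and P_G has a monomial
   dividing prod_v x_v^(k-1).  The hypothesis on m gives the degree bound
   m + |S| <= n(k-1), because S misses every pair of classes of even size
   (resp. of odd size) joined by an even number of edges.
   AT(G) >= k: the same formula, on the grid given by the exponents of a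
   monomial of P_G, yields a proper coloring with AT(G) colors. *)
Require Import Defs.
From mathcomp Require Import all_boot all_order all_algebra all_fingroup.
From mathcomp Require Import mpoly.
From mathcomp Require Import zify.

Set Implicit Arguments.
Unset Strict Implicit.
Unset Printing Implicit Defensive.

Import Order.TTheory GRing.Theory Num.Theory.
Local Open Scope ring_scope.

(** * Lagrange interpolation and coefficients on a grid *)

(** Interpolate ['X^u] at the nodes [x i], [i] in [T], and compare coefficients of degree [#|T|.-1]:
    the products [L i] are monic of that degree. *)
Lemma lagrange_moment (F : fieldType) (I : finType) (x : I -> F)
    (T : {set I}) (u : nat) :
    injective x -> (u < #|T|)%N ->
  \sum_(i in T) x i ^+ u * \prod_(j in T :\ i) (x i - x j)^-1
    = (u.+1 == #|T|)%:R.
Proof.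
move=> x_inj ltuT.
pose w i := \prod_(j in T :\ i) (x i - x j)^-1.
pose L i := \prod_(j in T :\ i) ('X - (x j)%:P).
have sizeL i : i \in T -> size (L i) = #|T|.
  move=> Ti; rewrite /L -big_enum size_prod_XsubC -cardE.
  by rewrite (cardsD1 i T) Ti.
have interp : \sum_(i in T) (x i ^+ u * w i) *: L i = 'X^u.
  apply/eqP; rewrite -subr_eq0; apply/eqP.
  apply: (@roots_geq_poly_eq0 _ _ [seq x i | i <- enum T]).
  - apply/allP => y /mapP[i]; rewrite mem_enum => Ti ->{y}.
    rewrite rootE hornerD hornerN hornerXn horner_sum (bigD1 i) //=.
    rewrite big1 => [|j /andP[Tj neq_ji]]; last first.
      rewrite hornerZ horner_prod (bigD1 i) /=; last first.
        by rewrite !inE eq_sym neq_ji.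
      by rewrite hornerXsubC subrr mul0r mulr0.
    rewrite addr0 hornerZ horner_prod -mulrA -big_split /=.
    rewrite big1 ?mulr1 ?subrr // => j; rewrite !inE => /andP[neq_ji _].
    rewrite hornerXsubC mulVf // subr_eq0; apply: contraNneq neq_ji.
    by move=> /x_inj ->.
  - by rewrite map_inj_uniq ?enum_uniq.
  - rewrite size_map -cardE (leq_trans (size_polyD _ _)) // geq_max size_polyN.
    rewrite size_polyXn ltuT andbT; rewrite (leq_trans (size_sum _ _ _)) //.
    apply/bigmax_leqP => i Ti.
    by rewrite (leq_trans (size_scale_leq _ _)) ?sizeL.
have := congr1 (fun p : {poly F} => p`_#|T|.-1) interp.
rewrite coef_sum coefXn => E.
have -> : (u.+1 == #|T|) = (#|T|.-1 == u) by lia.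
rewrite -E.
apply: eq_bigr => i Ti; rewrite coefZ -(sizeL i Ti) -lead_coefE.
by rewrite (monicP (monic_prod_XsubC _ _ _)) mulr1.
Qed.

(** The sum splits over the monomials [u] of [f], and each part factors into one moment per
    variable; only [u = t] survives. *)
Lemma mcoeff_grid (F : fieldType) (n : nat) (I : finType) (x : I -> F)
    (T : 'I_n -> {set I}) (t : 'X_{1..n}) (f : {mpoly F[n]}) :
    injective x -> (forall v, #|T v| = (t v).+1) ->
    (msize f <= (mdeg t).+1)%N ->
  f@_t = \sum_(a in family T)
           f.@[x \o a] * \prod_v \prod_(j in T v :\ a v) (x (a v) - x j)^-1.
Proof.
move=> x_inj cardT degf.
have -> : f@_t = \sum_(u <- msupp f) f@_u * (u == t)%:R.
  have [tf|tNf] := boolP (t \in msupp f).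
    rewrite (bigD1_seq t) ?msupp_uniq //= eqxx mulr1.
    by rewrite big1 ?addr0 // => u /negPf->; rewrite mulr0.
  rewrite (memN_msupp_eq0 tNf) big_seq big1 // => u uf.
  by case: eqP uf => [->|_ _]; [rewrite (negPf tNf) | rewrite mulr0].
under [RHS]eq_bigr => a _ do rewrite mevalE mulr_suml.
rewrite exchange_big /=; apply: eq_big_seq => u uf.
under eq_bigr => a _ do rewrite -mulrA -big_split /=.
rewrite -mulr_sumr -(bigA_distr_big_dep _ (fun v i =>
  x i ^+ u v * \prod_(j in T v :\ i) (x i - x j)^-1)); congr (_ * _).
have degu : (mdeg u <= mdeg t)%N.
  by rewrite -ltnS (leq_trans _ degf) // msize_mdeg_lt.
have [->|neq_ut] := eqVneq u t.
  by rewrite big1 // => v _; rewrite lagrange_moment ?cardT ?eqxx.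
(* The degree bound forces such a [v], and its factor vanishes; where [u v] exceeds [t v],
   [lagrange_moment] says nothing. *)
have [v lt_uv] : exists v, (u v < t v)%N.
  apply/existsP; apply: contraNT neq_ut; rewrite negb_exists => /forallP ge_ut.
  have le_tu v : (t v <= u v)%N by rewrite leqNgt ge_ut.
  apply/eqP/mnmP => v; apply/eqP; rewrite eqn_leq le_tu andbT leqNgt.
  apply/negP => lt_tu; move: degu; rewrite leqNgt !mdegE => /negP[].
  rewrite (bigD1 v) // [ltnRHS](bigD1 v) //= -addSn leq_add //.
  by apply: leq_sum => j _.
rewrite (bigD1 v) //= lagrange_moment ?cardT ?ltnS 1?ltnW //.
by rewrite eqSS (ltn_eqF lt_uv) mul0r.
Qed.

(** * Degree and values of the graph polynomial *)

Lemma dhomog_prod_subX (R : comNzRingType) (n : nat) (I : finType)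
    (D : {set I}) (f g : I -> 'I_n) :
  \prod_(p in D) ('X_(f p) - 'X_(g p)) \is [in R[n], #|D|.-homog].
Proof.
rewrite -sum1_card; elim/big_rec2: _ => [|p d q _ dq]; first exact: dhomog1.
by apply: dhomogM => //; rewrite rpredB // dhomogX /= mdeg1.
Qed.

Lemma dhomog_msize_le (R : nzRingType) (n d : nat) (p : {mpoly R[n]}) :
  p \is d.-homog -> (msize p <= d.+1)%N.
Proof.
move=> /dhomogP pd; rewrite msizeE; apply/bigmax_leqP_seq => u up _.
by rewrite -(pd u up).
Qed.

Lemma meval_graph_poly (R : realFieldType) (n : nat) (G : sgraph n)
    (y : 'I_n -> R) :
  (graph_poly R G).@[y] = \prod_(p in edges G) (y p.1 - y p.2).
Proof.
by rewrite rmorph_prod; apply: eq_bigr => p _; rewrite rmorphB /= !mevalXU.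
Qed.

Lemma meval_graph_poly_proper (R : realFieldType) (n k : nat) (G : sgraph n)
    (x : 'I_k -> R) (a : {ffun 'I_n -> 'I_k}) :
  (graph_poly R G).@[x \o a] != 0 -> proper_coloring G a.
Proof.
rewrite meval_graph_poly => /prodf_neq0 ne0.
have edge (u v : 'I_n) : (u < v)%N -> G u v -> a u != a v.
  move=> lt_uv Guv; have := ne0 (u, v); rewrite inE lt_uv Guv subr_eq0.
  by move=> /(_ isT); apply: contraNneq => /= ->.
move=> u v Guv; have [lt_uv|lt_vu|/val_inj eq_uv] := ltngtP u v.
- exact: edge.
- by rewrite eq_sym edge // adj_sym.
- by rewrite eq_uv adj_irr in Guv.
Qed.

Lemma natr_ord_inj (R : numDomainType) (k : nat) :
  injective (fun i : 'I_k => (i : nat)%:R : R).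
Proof. by move=> i j /eqP; rewrite eqr_nat => /eqP/val_inj. Qed.

(* The combinatorial Nullstellensatz on {0..t_1} x ... x {0..t_n}, for the
   exponents t of a monomial of the graph polynomial. *)
Lemma AT_choosable_colorable (R : realFieldType) (n k : nat) (G : sgraph n) :
  AT_choosable R G k ->
  exists a : {ffun 'I_n -> 'I_k}, proper_coloring G a.
Proof.
move=> /hasP[t tP /forallP lt_tk].
pose x (i : 'I_k) : R := (i : nat)%:R.
have cardT v : #|[set i : 'I_k | (i < (t v).+1)%N]| = (t v).+1.
  rewrite cardsE -sum1_card (big_ord_narrow (lt_tk v)) /=.
  by rewrite sum_nat_const card_ord muln1.
have homP := dhomog_prod_subX R (edges G) fst snd.
have degP : (msize (graph_poly R G) <= (mdeg t).+1)%N.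
  by move/dhomogP: (homP) => ->; rewrite ?dhomog_msize_le.
move: tP; rewrite mcoeff_msupp (mcoeff_grid (@natr_ord_inj R k) cardT degP).
move=> sum_neq0; have [a] :
    exists a : {ffun 'I_n -> 'I_k}, (graph_poly R G).@[x \o a] != 0.
  apply/existsP; apply: contraNT sum_neq0; rewrite negb_exists => /forallP eq0.
  by rewrite big1 // => a _; rewrite (eqP (negPn (eq0 a))) mul0r.
by move=> /meval_graph_poly_proper; exists a.
Qed.

(** * Products over pairs of color classes *)

Lemma big_offdiag (R : Type) (idx : R) (op : Monoid.com_law idx) (k : nat)
    (F : 'I_k -> 'I_k -> R) :
  \big[op/idx]_i \big[op/idx]_(j | j != i) F i j
    = \big[op/idx]_(q : 'I_k * 'I_k | (q.1 < q.2)%N)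
        op (F q.1 q.2) (F q.2 q.1).
Proof.
rewrite pair_big_dep /= (bigID (fun q : 'I_k * 'I_k => (q.1 < q.2)%N)) /=.
rewrite big_split /=; congr (op _ _).
  by apply: eq_bigl => -[i j] /=; rewrite -val_eqE /=; lia.
have swapK : involutive (fun q : 'I_k * 'I_k => (q.2, q.1)) by case.
rewrite (reindex_inj (inv_inj swapK)) /=.
by apply: eq_bigl => -[i j] /=; rewrite -val_eqE /=; lia.
Qed.

(** Doubled, both sides count the ordered pairs of distinct elements of [B]. *)
Lemma card_ltn_pairs (k : nat) (B : {set 'I_k}) :
  #|[set q : 'I_k * 'I_k | [&& (q.1 < q.2)%N, q.1 \in B & q.2 \in B]]|
    = 'C(#|B|, 2).
Proof.
apply: double_inj; rewrite -!mul2n -mul_bin_diag bin1.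
transitivity (\sum_(i : 'I_k) \sum_(j | j != i) (i \in B) * (j \in B))%N.
  rewrite big_offdiag /= -sum1dep_card big_mkcondr big_distrr /=.
  by apply: eq_bigr => q _; case: (q.1 \in B); case: (q.2 \in B).
under eq_bigr => i _ do rewrite -big_distrr /=.
rewrite (bigID (mem B)) /= addnC big1 ?add0n => [|i /negPf->//].
rewrite -sum_nat_const; apply: eq_bigr => i Bi; rewrite Bi mul1n.
rewrite (cardsD1 i B) Bi /= -sum1_card [RHS]big_mkcond [LHS]big_mkcond /=.
by apply: eq_bigr => j _; rewrite !inE; case: eqP.
Qed.

Lemma prod_edges_classes (R : comNzRingType) (n k : nat) (G : sgraph n)
    (c : {ffun 'I_n -> 'I_k}) (rho : 'I_k -> 'I_k -> R) :
    proper_coloring G c -> (forall i j, rho i j = rho j i) ->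
  \prod_(p in edges G) rho (c p.1) (c p.2)
    = \prod_(q : 'I_k * 'I_k | (q.1 < q.2)%N)
        rho q.1 q.2 ^+ edges_between G (color_class c q.1) (color_class c q.2).
Proof.
move=> hc rhoC.
(* Sorting the two colors may reverse the orientation of the edge; the symmetry of [rho] absorbs
   this. *)
pose h (p : 'I_n * 'I_n) :=
  if (c p.1 < c p.2)%N then (c p.1, c p.2) else (c p.2, c p.1).
rewrite (partition_big h (fun q => q.1 < q.2)%N) => [|p]; last first.
  rewrite inE /h => /andP[_ /hc neq_c].
  by case: (ltngtP (c p.1) (c p.2)) neq_c => //= /val_inj->; rewrite eqxx.
apply: eq_bigr => -[i j] /= lt_ij.
rewrite /edges_between -prodr_const; apply: eq_big => [p|p].
  rewrite !inE; apply: andb_id2l => /andP[_ /hc].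
  rewrite /h; case: ltnP => [lt_c|le_c] neq_c; apply/eqP/orP => /=.
  - by case=> <- <-; left; rewrite !eqxx.
  - case=> /andP[/eqP eq1 /eqP eq2].
      by rewrite eq1 eq2.
    by rewrite eq1 eq2 in lt_c; lia.
  - by case=> <- <-; right; rewrite !eqxx.
  - case=> /andP[/eqP eq1 /eqP eq2].
      by rewrite eq1 eq2 in le_c; lia.
    by rewrite eq1 eq2.
by move=> /andP[_]; rewrite /h; case: ifP => _ /eqP[<- <-].
Qed.

(** For [i < j], the factor [F i j] comes once from each vertex of class [i] and, as [F j i], once
    from each vertex of class [j]. *)
Lemma prod_offdiag_classes (R : comNzRingType) (n k : nat)
    (c : {ffun 'I_n -> 'I_k}) (F : 'I_k -> 'I_k -> R) :
    (forall i j, F i j = F j i) ->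
  \prod_v \prod_(j | j != c v) F (c v) j
    = \prod_(q : 'I_k * 'I_k | (q.1 < q.2)%N)
        F q.1 q.2 ^+ (#|color_class c q.1| + #|color_class c q.2|).
Proof.
move=> FC.
rewrite (partition_big c xpredT) //=.
transitivity (\prod_(i : 'I_k) \prod_(j | j != i)
    F i j ^+ #|color_class c i|); last first.
  by rewrite big_offdiag; apply: eq_bigr => q _; rewrite exprD (FC q.2).
apply: eq_bigr => i _; rewrite prodrXl -prodr_const.
by apply: eq_big => [v|v /eqP->//]; rewrite inE.
Qed.

(** The set S of the overview: the pairs that need one extra factor to make their exponent even. *)
Definition parity_pairs (n k : nat) (G : sgraph n)
    (A : 'I_k -> {set 'I_n}) : {set 'I_k * 'I_k} :=
  [set q : 'I_k * 'I_k | (q.1 < q.2)%N &&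
    odd (edges_between G (A q.1) (A q.2) + (#|A q.1| + #|A q.2|))].

(** Grouped by pairs [i < j], the exponent of [rho i j] is [e + odd (e + a) - a], with [e] the
    number of edges between the two classes and [a] their total size; it is even. *)
Lemma coloring_sign_gt0 (R : realFieldType) (n k : nat) (G : sgraph n)
    (c : {ffun 'I_n -> 'I_k}) (rho : 'I_k -> 'I_k -> R) :
    proper_coloring G c -> (forall i j, rho i j = rho j i) ->
    (forall i j, i != j -> rho i j != 0) ->
  0 < \prod_(p in edges G) rho (c p.1) (c p.2)
      * \prod_(q in parity_pairs G (color_class c)) rho q.1 q.2
      * \prod_v \prod_(j | j != c v) (rho (c v) j)^-1.
Proof.
move=> hc rhoC rho_neq0.
rewrite (prod_edges_classes hc rhoC).
rewrite (prod_offdiag_classes _ (F := fun i j => (rho i j)^-1)); last first.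
  by move=> i j; rewrite rhoC.
rewrite (eq_bigl _ _ (in_set _)) big_mkcondr /= -!big_split /=.
apply: prodr_gt0 => -[i j] /= lt_ij.
set e := edges_between _ _ _; set a := (#|color_class c i| + _)%N.
have {}rho_neq0 : rho i j != 0 by rewrite rho_neq0 // -val_eqE /= ltn_eqF.
have -> : (if odd (e + a) then rho i j else 1) = rho i j ^+ odd (e + a).
  by case: odd.
(* Trading the inverse power for [rho i j ^+ a] times a square keeps the exponents natural. *)
have -> : rho i j ^+ e * rho i j ^+ odd (e + a) * (rho i j)^-1 ^+ a
    = rho i j ^+ (e + odd (e + a) + a) * ((rho i j)^-1 ^+ a) ^+ 2.
  rewrite -exprD [in RHS]exprD expr2 mulrA -(mulrA (_ ^+ _) (_ ^+ a)).
  by rewrite -exprMn divff // expr1n mulr1.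
apply: mulr_gt0.
  rewrite lt0r expf_neq0 //= exprn_even_ge0 //.
  by rewrite addnAC oddD oddb addbb.
by rewrite exprn_even_gt0 //= expf_neq0 ?invr_eq0.
Qed.

(** Two classes of the same parity [b] have even total size, so their pair is in [parity_pairs] only
    if an odd number of edges joins them. *)
Lemma card_parity_pairs (n k : nat) (G : sgraph n)
    (A : 'I_k -> {set 'I_n}) (b : bool) :
  (#|parity_pairs G A| + 'C(nb_classes A b, 2)
     <= 'C(k, 2) + nb_odd_pairs G A b)%N.
Proof.
have -> : 'C(k, 2) = #|[set q : 'I_k * 'I_k | (q.1 < q.2)%N]|.
  rewrite -[k in LHS]card_ord -cardsT -card_ltn_pairs.
  by apply: eq_card => q; rewrite !inE !andbT.
rewrite /nb_classes -card_ltn_pairs; set U := [set q : 'I_k * 'I_k | _ ].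
rewrite -(cardsID [set q | odd (edges_between G (A q.1) (A q.2))] U).
rewrite addnCA addnC leq_add //.
  have disj : [disjoint parity_pairs G A
      & U :\: [set q | odd (edges_between G (A q.1) (A q.2))]].
    rewrite -setI_eq0; apply/eqP/setP => q; rewrite !inE !oddD.
    case: (odd (edges_between _ _ _)); rewrite ?andbF //=.
    by case: (odd #|A q.1|) (odd #|A q.2|) (b) => [] [] []; rewrite ?andbF.
  rewrite -(cardsUI _ (_ :\: _)) (disjoint_setI0 disj) cards0 addn0.
  apply/subset_leq_card/subsetP => q; rewrite !inE.
  by case: ltnP; rewrite ?andbF.
apply/subset_leq_card/subsetP => q; rewrite !inE.
by rewrite -!andbA => /and4P[-> -> -> ->].
Qed.

(** * The two bounds on the Alon-Tarsi number *)

(** What the definition grants to one coloring [c0] passes to any proper [c] through the permutation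
    relating them. *)
Lemma uniquely_colorable_surj (n k : nat) (G : sgraph n)
    (c : {ffun 'I_n -> 'I_k}) :
    uniquely_colorable G k -> proper_coloring G c ->
  (forall i, exists v, c v = i) /\
  (forall c' : {ffun 'I_n -> 'I_k}, proper_coloring G c' ->
     exists s : {perm 'I_k}, forall v, c' v = s (c v)).
Proof.
move=> [c0 [_ c0_surj c0_uniq]] /c0_uniq[s0 c_s0]; split.
  move=> i; have /set0Pn[v] := c0_surj ((s0^-1)%g i).
  by rewrite inE => /eqP c0v; exists v; rewrite c_s0 c0v permKV.
move=> c' /c0_uniq[s c'_s]; exists (s0^-1 * s)%g => v.
by rewrite c'_s c_s0 permM permK.
Qed.

Lemma AT_choosable_leq (R : realFieldType) (n k k' : nat) (G : sgraph n) :
  uniquely_colorable G k -> AT_choosable R G k' -> (k <= k')%N.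
Proof.
move=> hG /AT_choosable_colorable[a ha]; rewrite leqNgt; apply/negP => lt_k'k.
have [c [hc _ _]] := hG; have [c_surj c_uniq] := uniquely_colorable_surj hG hc.
have [|s a_s] := c_uniq [ffun v => widen_ord (ltnW lt_k'k) (a v)].
  by move=> u v /ha; rewrite !ffunE -!val_eqE.
(* The widened coloring never takes the value [k'], yet [s] composed with the surjective [c]
   does. *)
have [v c_v] := c_surj ((s^-1)%g (Ordinal lt_k'k)).
have := congr1 val (a_s v); rewrite ffunE c_v permKV /= => a_v.
by have := ltn_ord (a v); rewrite a_v ltnn.
Qed.

Lemma AT_choosable_of_card (R : realFieldType) (n k : nat) (G : sgraph n)
    (c : {ffun 'I_n -> 'I_k}) :
    uniquely_colorable G k -> proper_coloring G c -> (0 < k)%N ->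
    (#|edges G| + #|parity_pairs G (color_class c)| <= n * k.-1)%N ->
  AT_choosable R G k.
Proof.
move=> hG hc k_gt0; set S := parity_pairs G _ => card_le.
have [c_surj c_uniq] := uniquely_colorable_surj hG hc.
have /fin_all_exists[r cr] := c_surj.
pose x (i : 'I_k) : R := (i : nat)%:R.
have x_inj : injective x by exact: natr_ord_inj.
pose Q : {mpoly R[n]} := \prod_(q in S) ('X_(r q.1) - 'X_(r q.2)).
pose t : 'X_{1..n} := [multinom k.-1 | v < n].
pose T (v : 'I_n) := [set: 'I_k].
have cardT v : #|T v| = (t v).+1 by rewrite cardsT card_ord mnmE prednK.
have degPQ : (msize (graph_poly R G * Q) <= (mdeg t).+1)%N.
  have homPQ := dhomogM (dhomog_prod_subX R (edges G) fst snd)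
    (dhomog_prod_subX R S (r \o fst) (r \o snd)).
  apply: leq_trans (dhomog_msize_le homPQ) _; rewrite ltnS mdegE.
  under eq_bigr => v _ do rewrite mnmE.
  by rewrite sum_nat_const card_ord.
pose term (a : {ffun 'I_n -> 'I_k}) := (graph_poly R G * Q).@[x \o a]
  * \prod_v \prod_(j in T v :\ a v) (x (a v) - x j)^-1.
(* Along a recoloring [s \o c], the vertices [r i] turn [Q] into the product of
   the differences indexed by [S], so [term (s \o c) * term c] is a product of
   [rho i j] = (x (s i) - x (s j)) (x i - x j), to which parity applies. *)
have term_perm (s : {perm 'I_k}) (a : {ffun 'I_n -> 'I_k}) :
    (forall v, a v = s (c v)) ->
  term a = \prod_(p in edges G) (x (s (c p.1)) - x (s (c p.2)))
    * \prod_(q in S) (x (s q.1) - x (s q.2))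
    * \prod_v \prod_(j | j != c v) (x (s (c v)) - x (s j))^-1.
  move=> a_s; rewrite /term rmorphM /= meval_graph_poly; congr (_ * _ * _).
  - by apply: eq_bigr => p _ /=; rewrite !a_s.
  - rewrite rmorph_prod; apply: eq_bigr => q _.
    by rewrite rmorphB /= !mevalXU /= !a_s !cr.
  - apply: eq_bigr => v _; rewrite (reindex_inj (@perm_inj _ s)) a_s.
    by apply: eq_bigl => j; rewrite !inE andbT (inj_eq perm_inj).
have term_gt0 a : proper_coloring G a -> 0 < term a * term c.
  pose e : {perm 'I_k} := 1%g.
  move=> /c_uniq[s a_s]; rewrite (term_perm s a a_s).
  rewrite (term_perm e c) => [|v]; last by rewrite perm1.
  pose rho i j := (x (s i) - x (s j)) * (x (e i) - x (e j)).
  rewrite mulrACA [X in X * _]mulrACA -!big_split /=.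
  rewrite [X in _ * X](eq_bigr (fun v =>
    \prod_(j | j != c v) (rho (c v) j)^-1)).
    apply: coloring_sign_gt0 => // [i j|i j neq_ij].
      by rewrite /rho -mulrNN !opprB.
    by rewrite mulf_neq0 // subr_eq0 (inj_eq x_inj) (inj_eq perm_inj).
  by move=> v _; rewrite -big_split; apply: eq_bigr => j _; rewrite /rho invfM.
(* The factor [term c] spares computing the common sign: proper [a] contribute positively, all
   others zero. *)
have sum_gt0 : 0 < (graph_poly R G * Q)@_t * term c.
  rewrite (mcoeff_grid x_inj cardT degPQ) mulr_suml (bigD1 c) /=; last first.
    by apply/familyP => v; rewrite inE.
  rewrite ltr_pwDl ?term_gt0 // sumr_ge0 // => a _.
  have [Pa0|/meval_graph_poly_proper/term_gt0/ltW//] :=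
    eqVneq (graph_poly R G).@[x \o a] 0.
  by rewrite rmorphM /= Pa0 !mul0r.
have : (graph_poly R G * Q)@_t != 0.
  by apply: contraTneq sum_gt0 => ->; rewrite mul0r ltxx.
(* A monomial of the product is a monomial [u] of the graph polynomial times one of [Q], so [u]
   divides [t]. *)
rewrite -mcoeff_msupp => /msuppM_le/allpairsP[[u w] /= [uP _ t_uw]].
apply/hasP; exists u => //; apply/forallP => v.
by rewrite -(prednK k_gt0) ltnS -(mnmE (fun=> k.-1) v) -/t t_uw mnmDE leq_addr.
Qed.

Theorem theorem1p9 (R : realFieldType) (n k : nat) (G : sgraph n)
    (hG : uniquely_colorable G k)
    (c : {ffun 'I_n -> 'I_k}) (hc : proper_coloring G c) :
  let A := color_class c in
  let m := #|edges G| in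
  let r_o := nb_classes A true in
  let r_e := nb_classes A false in
  let p_o := nb_odd_pairs G A true in
  let p_e := nb_odd_pairs G A false in
  m%:Z <= Num.max
    ((n%:Z - r_o%:Z) * (k%:Z - 1) + ('C(r_o, 2))%:Z - p_e%:Z)
    ((n%:Z - r_e%:Z) * (k%:Z - 1) + ('C(r_e, 2))%:Z - p_o%:Z) ->
  AT R G = k.
Proof.
move=> A m r_o r_e p_o p_e le_m.
rewrite /AT; case: ex_minnP => k' k'AT min_k'; apply/eqP; rewrite eqn_leq.
rewrite (AT_choosable_leq hG k'AT) andbT; apply: min_k'.
(* If [k = 0], the map [c] leaves no vertices and any monomial qualifies vacuously. *)
have [k_eq0|k_gt0] := posnP k.
  apply/hasP; exists (mlead (graph_poly R G)).
    exact/mlead_supp/graph_poly_neq0.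
  by apply/forallP => v; have := leq_ltn_trans (leq0n _) (ltn_ord (c v)); lia.
apply: (AT_choosable_of_card R hG hc k_gt0).
have r_oe : (r_o + r_e = k)%N.
  rewrite -[RHS]card_ord -(cardsC [set i | odd #|A i| == true]).
  congr (_ + _)%N; apply: eq_card => i.
  by rewrite !inE eqb_id eqbF_neg.
have bin2E j : (2 * 'C(j, 2) + j = j * j)%N.
  by rewrite -mul_bin_diag bin1; case: j => // j; rewrite -mulnSr.
(* Here [r'] counts the classes of parity [b] and [r] the others; [bin_k] turns the hypothesis on
   [m] into the degree bound. *)
have bound (b : bool) (r r' : nat) : (r + r' = k)%N ->
    (#|parity_pairs G A| + 'C(r', 2) <= 'C(k, 2) + nb_odd_pairs G A b)%N ->
    m%:Z <= (n%:Z - r%:Z) * (k%:Z - 1) + ('C(r, 2))%:Z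
      - (nb_odd_pairs G A b)%:Z ->
  (m + #|parity_pairs G A| <= n * k.-1)%N.
  move=> rr'k.
  have bin_k : ('C(k, 2) + 'C(r, 2) = 'C(r', 2) + r * k.-1)%N.
    have rk : (r * k.-1 + r = r * k)%N by rewrite -mulnSr prednK.
    move: (bin2E k) (bin2E r) (bin2E r') rk; move: (r * _.-1)%N.
    by rewrite -rr'k; lia.
  have -> : k%:Z - 1 = k.-1%:Z by lia.
  by rewrite mulrBl; lia.
move: le_m; rewrite le_max => /orP[].
  by apply: bound r_oe _; exact: card_parity_pairs.
by apply: bound; [rewrite addnC | exact: card_parity_pairs].
Qed.
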